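(* Let $0<\alpha\le\beta$ be constants. There exists a family of strings $(s_n)_{n\ge1}$ over the alphabet $\{a,b\}$ such that $|s_n|=\Omega(2^n)$, $s_n$ is derived by an SLP of size $O(n)$, and every $(\alpha,\beta)$-path balanced SLP for $s_n$ has size $\Omega(n^2)$.
   Context: A straight-line program (SLP) is a context-free grammar in which every variable has exactly one rule and the variables can be linearly ordered so that each rule's right-hand side only contains terminals and later variables; each variable $A$ derives a unique string $\mathrm{val}(A)$, with $|A|=|\mathrm{val}(A)|$, and has a unique derivation tree. Its size is the total length of all right-hand sides. An SLP is in Chomsky normal form if every rule has the form $A\to BC$ or $A\to a$ with $B,C$ variables and $a$ a terminal. An SLP in Chomsky normal form is $(\alpha,\beta)$-path balanced, for constants $0<\alpha\le\beta$, if for every variable $A$ the length of every root-to-leaf path in the derivation tree of $A$ lies between $\alpha\log|A|$ and $\beta\log|A|$. *)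

(* Defs.v *)
From HB Require Import structures.
From mathcomp Require Import all_boot all_order all_algebra.
From mathcomp Require Import reals exp.

Set Implicit Arguments.
Unset Strict Implicit.
Unset Printing Implicit Defensive.

Import Order.TTheory GRing.Theory Num.Theory.

(* In the right-hand sides, [inl B] is a variable and [inr a] a terminal.
   The linear order on the variables is given by an injective numbering. *)
Record slp (T : eqType) := Slp {
  slp_var : finType;
  slp_rule : slp_var -> seq (slp_var + T);
  slp_start : slp_var;
  slp_acyclic : exists2 r : slp_var -> nat, injective r &
    forall A B : slp_var, inl B \in slp_rule A -> r A < r B
}.

Inductive dtree (V T : Type) : Type :=
  | DLeaf of T
  | DNode of V & seq (dtree V T).

Arguments DLeaf {V T}.
Arguments DNode {V T}.

Fixpoint dtree_yield (V T : Type) (t : dtree V T) : seq T :=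
  match t with
  | DLeaf a => [:: a]
  | DNode _ ts => flatten (map (@dtree_yield V T) ts)
  end.

(* The lengths (numbers of edges) of the paths from the root to the
   terminal-labelled leaves, from left to right. *)
Fixpoint dtree_path_lengths (V T : Type) (t : dtree V T) : seq nat :=
  match t with
  | DLeaf _ => [:: 0]
  | DNode _ ts => map succn (flatten (map (@dtree_path_lengths V T) ts))
  end.

Section SLP.
Variables (T : eqType) (G : slp T).

Definition slp_size : nat := \sum_(A : slp_var G) size (slp_rule A).

Fixpoint derive_fuel (k : nat) (x : slp_var G + T) : dtree (slp_var G) T :=
  match x with
  | inr a => DLeaf a
  | inl A => DNode A (if k is k'.+1 then map (derive_fuel k') (slp_rule A)
                      else [::])
  end.

(* By acyclicity no branch has more than #|slp_var G| variables, so the fuel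
   never runs out: see [derivation_treeE] below. *)
Definition derivation_tree (x : slp_var G + T) : dtree (slp_var G) T :=
  derive_fuel #|slp_var G| x.

Lemma derivation_treeE (A : slp_var G) :
  derivation_tree (inl A) = DNode A (map derivation_tree (slp_rule A)).
Proof.
have [r r_inj r_lt] := slp_acyclic G.
pose later (x : slp_var G + T) :=
  if x is inl B then #|[pred C | r B <= r C]| else 0.
have later_gt0 B : 0 < later (inl B).
  by rewrite /later; apply/card_gt0P; exists B; rewrite inE.
have later_rule B x : x \in slp_rule B -> later x < later (inl B).
  case: x => [C|a] xB; last exact: later_gt0.
  rewrite /later; apply: proper_card; apply/properP; split.
    by apply/subsetP => D; rewrite !inE; apply/leq_trans/ltnW/r_lt.
  by exists B; rewrite !inE ?leqnn // -ltnNge; apply: r_lt.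
have stable k l x : later x <= k -> later x <= l ->
    derive_fuel k x = derive_fuel l x.
  elim: k l x => [|k IHk] [|l] [B|a] //; try by rewrite leqNgt later_gt0.
    by move=> _; rewrite leqNgt later_gt0.
  move=> hk hl; congr DNode; apply/eq_in_map => x xB.
  by apply: IHk; rewrite -ltnS; apply: leq_trans (later_rule _ _ xB) _.
rewrite /derivation_tree (@stable _ #|slp_var G|.+1 (inl A)) ?max_card //.
by rewrite leqW // max_card.
Qed.

Definition slp_val (A : slp_var G) : seq T :=
  dtree_yield (derivation_tree (inl A)).

Definition slp_derives (s : seq T) : Prop := slp_val (slp_start G) = s.

Definition chomsky_nf : Prop :=
  forall A : slp_var G,
    (exists B C : slp_var G, slp_rule A = [:: inl B; inl C]) \/
    (exists a : T, slp_rule A = [:: inr a]).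

End SLP.

Local Open Scope ring_scope.

Definition log2 (R : realType) (x : R) : R := ln x / ln 2.

(* In a derivation tree of a Chomsky normal form SLP the leaves of the binary
   part are the variables with rule A -> a; the last, unary edge to the
   terminal is not counted in the length of a path, whence [l.-1].  If it
   were, a variable with |A| = 1 would have path length 1 > 0 = log |A|, and
   no SLP at all would be path balanced. *)
Definition path_balanced (R : realType) (alpha beta : R) (T : eqType)
    (G : slp T) : Prop :=
  chomsky_nf G /\
  forall (A : slp_var G) (l : nat),
    l \in dtree_path_lengths (derivation_tree (inl A)) ->
    alpha * log2 (size (slp_val A))%:R <= l.-1%:R
      <= beta * log2 (size (slp_val A))%:R.

(* Main.v *)
Require Import Defs.
From HB Require Import structures.
From mathcomp Require Import all_boot all_order all_algebra.
From mathcomp Require Import reals exp.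
From mathcomp Require Import zify ring lra.

(* s_n is the product of the blocks a^(2^n) b^i a b^i a^(2^n), 1 <= i <= n+1.
   Descend in a path balanced derivation tree towards the i-th block.  A cut
   through b^i a b^i leaves one copy of b^i intact, next to a run of a's.
   Cutting this copy as well would produce a child of length at most 2(n+1),
   whose paths have length O(log n); all paths from a variable of length at
   least 2^n have length Omega(n), so this happens only after Omega(n) steps.
   Thus Omega(n) variables have first or last b-run of length i, and every
   variable is counted for at most two values of i. *)

Set Implicit Arguments.
Unset Strict Implicit.
Unset Printing Implicit Defensive.

Import Order.TTheory GRing.Theory Num.Theory.

(** * Runs of b's in a word *)

Definition first_run (w : seq bool) : nat := find negb (drop (find id w) w).

(** Only the letters up to position [x + i] are prescribed, so the word may end with the run or
    continue arbitrarily after the a that closes it. *)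
Lemma first_runE (w : seq bool) (x i : nat) :
    0 < i -> x + i <= size w ->
    (forall k, k < size w -> k <= x + i -> nth false w k = (x <= k < x + i)) ->
  first_run w = i.
Proof.
move=> i_gt0 le_w wE; rewrite /first_run.
have -> : find id w = x.
  case: findP => [/hasPn no_b | j lt_j /(_ false) wj lt_wj].
    have lt_x : x < size w by lia.
    by have /no_b := mem_nth false lt_x; rewrite wE /=; lia.
  have [ltjx|ltxj|//] := ltngtP j x; first by rewrite wE /= in wj; lia.
  by have := lt_wj false x ltxj; rewrite wE; lia.
case: findP => [/hasPn no_a | j].
  rewrite size_drop; have [lt_w|ge_w] := ltnP (x + i) (size w); last by lia.
  have lt_i : i < size (drop x w) by rewrite size_drop; lia.
  by have /no_a := mem_nth false lt_i; rewrite nth_drop wE //; lia.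
rewrite size_drop => lt_j /(_ false); rewrite nth_drop => wj lt_wj.
have [ltji|ltij|//] := ltngtP j i; first by rewrite wE in wj; lia.
by have := lt_wj false i ltij; rewrite nth_drop wE; lia.
Qed.

(** * Paths and descent in derivation trees of Chomsky normal form SLPs *)

Section ChomskyNormalForm.
Variables (T : eqType) (G : slp T).

Notation paths A := (dtree_path_lengths (derivation_tree (inl A : slp_var G + T))).

Lemma slp_valE (A : slp_var G) :
  slp_val A =
    flatten [seq dtree_yield (derivation_tree x) | x <- slp_rule A].
Proof. by rewrite /slp_val derivation_treeE /= -map_comp. Qed.

Lemma slp_val_pair (A B C : slp_var G) :
  slp_rule A = [:: inl B; inl C] -> slp_val A = slp_val B ++ slp_val C.
Proof. by move=> rA; rewrite slp_valE rA /= cats0. Qed.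

Lemma paths_pair (A B C : slp_var G) :
  slp_rule A = [:: inl B; inl C] -> paths A = map succn (paths B ++ paths C).
Proof. by move=> rA; rewrite derivation_treeE rA /= cats0. Qed.

Lemma paths_terminal (A : slp_var G) (a : T) :
  slp_rule A = [:: inr a] -> paths A = [:: 1].
Proof.
by move=> rA; rewrite derivation_treeE rA /= /derivation_tree; case: #|_|.
Qed.

Lemma yield_terminal (a : T) :
  dtree_yield (derivation_tree (inr a : slp_var G + T)) = [:: a].
Proof. by rewrite /derivation_tree; case: #|_|. Qed.

Hypothesis cnf : chomsky_nf G.

Lemma paths_gt0 (A : slp_var G) (l : nat) : l \in paths A -> 0 < l.
Proof. by rewrite derivation_treeE /= => /mapP[k _ ->]. Qed.

Lemma slp_size_ge_card : #|slp_var G| <= slp_size G.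
Proof.
rewrite -sum1_card /slp_size; apply: leq_sum => A _.
by case: (cnf A) => [[B [C ->]]|[a ->]].
Qed.

Lemma slp_height :
  exists h : slp_var G -> nat,
    forall A B, inl B \in slp_rule A -> h B < h A.
Proof.
have [r _ r_lt] := slp_acyclic G; exists (fun A => \max_C r C - r A) => A B BA.
have := r_lt _ _ BA; have := leq_bigmax (F := r) B; lia.
Qed.

Lemma paths_nonempty (A : slp_var G) : exists l, l \in paths A.
Proof.
have [h h_lt] := slp_height.
have [k] := ubnP (h A); elim: k A => // k IHk A lt_hA.
case: (cnf A) => [[B [C rA]]|[a /paths_terminal ->]]; last by exists 1.
have [|l lB] := IHk B; first by have := h_lt A B; rewrite rA inE eqxx; lia.
by exists l.+1; rewrite (paths_pair rA) map_f // mem_cat lB.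
Qed.

(* [Q] says that a variable is still relevant; relevance passes to a child
   until some child has a path of length at most [U].  The relevant variables
   not counted by [marked] have only paths of length at least [D], so they use
   up a single unit of the length that remains to be covered. *)
Lemma card_marked (marked : pred (slp_var G)) (Q : slp_var G -> Prop)
    (D U : nat) (S : slp_var G) :
    (forall A B C, slp_rule A = [:: inl B; inl C] -> Q A ->
       exists2 X, X \in [:: B; C] &
         Q X \/ (forall l, l \in paths X -> l.-1 <= U)) ->
    (forall A, Q A -> marked A \/ (forall l, l \in paths A -> D <= l.-1)) ->
    Q S -> (forall l, l \in paths S -> D <= l.-1) ->
  D <= #|marked| + U + 2.
Proof.
move=> Q_step Q_marked QS D_S; have [h h_lt] := slp_height.
(* Counting only heights up to [h A] lets a marked [A] drop out of the count at its child, which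
   pays for the lost edge. The cap [e <= D.-1] is the single unit: below an unmarked [A] all paths
   still have length at least [D.-1], so [e] is kept. *)
suff claim k A e : h A < k -> Q A -> (forall l, l \in paths A -> e <= l.-1) ->
    e <= D.-1 -> e <= #|[pred B | marked B & h B <= h A]| + U + 1.
  have le_marked : #|[pred B | marked B & h B <= h S]| <= #|marked|.
    by apply/subset_leq_card/subsetP => B; rewrite !inE => /andP[].
  have D1_S l : l \in paths S -> D.-1 <= l.-1 by move/D_S; lia.
  by have := claim _ S D.-1 (ltnSn _) QS D1_S (leqnn _); lia.
elim: k A e => // k IHk A e lt_hA QA e_A e_le.
case: (cnf A) => [[B [C rA]]|[a /paths_terminal pA]]; last first.
  by have := e_A 1; rewrite pA inE => /(_ isT); lia.
have [X X_BC QX] := Q_step _ _ _ rA QA.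
have succ_path l : l \in paths X -> l.+1 \in paths A.
  rewrite (paths_pair rA) => lX; apply: map_f; rewrite mem_cat.
  by move: X_BC lX; rewrite !inE => /orP[]/eqP-> ->; rewrite ?orbT.
have lt_hX : h X < h A.
  by apply: h_lt; rewrite rA; move: X_BC; rewrite !inE.
case: QX => [QX|U_X]; last first.
  have [l lX] := paths_nonempty X.
  by have := U_X _ lX; have := e_A _ (succ_path _ lX); lia.
case: (Q_marked A QA) => [mA|D_A].
  have : e.-1 <= #|[pred B | marked B & h B <= h X]| + U + 1.
    apply: IHk => // [|l lX|]; [lia| |lia].
    by have := e_A _ (succ_path _ lX); have := paths_gt0 lX; lia.
  suff: #|[pred B | marked B & h B <= h X]| < #|[pred B | marked B & h B <= h A]|.
    by lia.
  apply/proper_card/properP; split.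
    by apply/subsetP => Y; rewrite !inE => /andP[->]; lia.
  by exists A; rewrite !inE ?mA ?leqnn // -ltnNge.
apply: leq_trans (_ : #|[pred B | marked B & h B <= h X]| + U + 1 <= _).
  apply: IHk => // [|l lX]; first by lia.
  by have := D_A _ (succ_path _ lX); lia.
rewrite !leq_add2r; apply/subset_leq_card/subsetP => Y.
by rewrite !inE => /andP[->]; lia.
Qed.

End ChomskyNormalForm.

(** * Variables forced by one block, centred at the a in position [m] *)

Lemma card_run (G : slp bool) (s : seq bool) (N K D U m i : nat) :
    chomsky_nf G -> slp_derives G s ->
    (forall (A : slp_var G) l,
       l \in dtree_path_lengths (derivation_tree (inl A)) ->
       N <= size (slp_val A) -> D <= l.-1) ->
    (forall (A : slp_var G) l,
       l \in dtree_path_lengths (derivation_tree (inl A)) ->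
       size (slp_val A) <= K -> l.-1 <= U) ->
    0 < i -> i + N <= m -> m + i + N < size s -> 2 * i <= K ->
    (forall k, m <= k + (i + N) -> k <= m + (i + N) ->
       nth false s k = (k != m) && (m <= k + i) && (k <= m + i)) ->
  D <= #|[pred A : slp_var G | first_run (slp_val A) == i]|
       + #|[pred A : slp_var G | first_run (rev (slp_val A)) == i]| + U + 2.
Proof.
move=> cnf Gs D_paths U_paths i_gt0 le_m lt_s le_K sE.
pose occurs (w : seq bool) l :=
  forall k, k < size w -> nth false w k = nth false s (l + k).
pose relevant l r := l <= m - i /\ m <= r \/ l <= m.+1 /\ m + i < r.
(* A factor is relevant if it contains the left or the right copy of b^i. If [c] cuts the only copy
   it contains, the part on the side of [m] has length at most 2i. *)
have cut l c r : relevant l r ->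
    relevant l c \/ relevant c r \/ c <= l + K \/ r <= c + K.
  by rewrite /relevant; lia.
(* A factor shorter than [N] that contains the left copy starts within the window, so only a's
   precede this copy; likewise only a's follow the right copy. On the other side the a at [m], or
   the end of the factor, closes the run. *)
have runs (w : seq bool) l : occurs w l -> relevant l (l + size w) ->
    size w < N -> (first_run w == i) || (first_run (rev w) == i).
  move=> occ_w rel_w lt_w; apply/orP.
  case: rel_w => [[le_l le_r]|[le_l le_r]].
    left; apply/eqP; apply: (@first_runE _ (m - i - l)); [lia|lia|].
    by move=> k lt_k le_k; rewrite occ_w // sE; lia.
  right; apply/eqP.
  apply: (@first_runE _ (l + size w - (m + i).+1)); rewrite ?size_rev.
  + lia.
  + lia.
  + by move=> k lt_k le_k; rewrite nth_rev // occ_w ?sE; lia.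
pose marked := [pred A : slp_var G | (first_run (slp_val A) == i)
                  || (first_run (rev (slp_val A)) == i)].
pose Q (A : slp_var G) :=
  exists2 l, occurs (slp_val A) l & relevant l (l + size (slp_val A)).
apply: (@leq_trans (#|marked| + U + 2)); last first.
  rewrite !leq_add2r -cardUI.
  apply: leq_trans (leq_addr _ _); apply/subset_leq_card/subsetP => A.
  by rewrite !inE.
apply: (@card_marked _ _ cnf marked Q D U (slp_start G)).
- move=> A B C rA [l occA relA]; move: occA relA.
  rewrite (slp_val_pair rA) /occurs size_cat => occA relA.
  have occB : occurs (slp_val B) l.
    by move=> k lt_k; rewrite -occA ?nth_cat ?lt_k ?ltn_addr.
  have occC : occurs (slp_val C) (l + size (slp_val B)).
    move=> k lt_k; rewrite -addnA -occA ?ltn_add2l //.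
    by rewrite nth_cat ltnNge leq_addr /= addKn.
  have := cut l (l + size (slp_val B)) _ relA; rewrite addnA !leq_add2l.
  case=> [relB|[relC|[szB|szC]]].
  + by exists B; rewrite ?inE ?eqxx //; left; exists l.
  + exists C; rewrite ?inE ?eqxx ?orbT //; left.
    by exists (l + size (slp_val B)).
  + by exists B; rewrite ?inE ?eqxx //; right=> k /U_paths; apply.
  + by exists C; rewrite ?inE ?eqxx ?orbT //; right=> k /U_paths; apply.
- move=> A [l occA relA].
  have [szN|szN] := leqP N (size (slp_val A)).
    by right=> k /D_paths; apply.
  by left; exact: (runs _ _ occA relA szN).
- have rel_s : relevant 0 (0 + size s) by rewrite /relevant; lia.
  by exists 0; rewrite Gs.
- have le_N : N <= size s by lia.
  by move=> l /D_paths; rewrite Gs; apply.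
Qed.

(** * The strings s_n and their blocks *)

Definition block (N i : nat) : seq bool :=
  nseq N false ++ nseq i true ++ [:: false] ++ nseq i true ++ nseq N false.

Definition comb (n : nat) : seq bool :=
  flatten [seq block (2 ^ n) i.+1 | i : 'I_n.+1].

Lemma size_block (N i : nat) : size (block N i) = (N + i) + (N + i).+1.
Proof. by rewrite !size_cat !size_nseq /=; lia. Qed.

Lemma nth_block (N i k : nat) :
  nth false (block N i) k = (k != N + i) && (N <= k) && (k <= N + i + i).
Proof.
rewrite /block -[[:: false]]/(nseq 1 false) !nth_cat !size_nseq !nth_nseq.
by do !case: ltnP => ?; lia.
Qed.

Lemma block_center (N i : nat) (pre post : seq bool) :
  let s := pre ++ block N i ++ post in
  exists m, [/\ i + N <= m, m + i + N < size s &
    forall k, m <= k + (i + N) -> k <= m + (i + N) ->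
      nth false s k = (k != m) && (m <= k + i) && (k <= m + i)].
Proof.
(* The position of the a between the two copies of b^i. *)
exists (size pre + N + i); split.
- lia.
- by rewrite size_cat [size (block _ _ ++ _)]size_cat size_block; lia.
move=> k ge_k le_k; rewrite nth_cat; case: ltnP => [|le_pre]; first by lia.
rewrite nth_cat size_block; case: ltnP => [_|]; last by lia.
by rewrite nth_block; lia.
Qed.

Lemma comb_block (n : nat) (i : 'I_n.+1) :
  exists m, [/\ i.+1 + 2 ^ n <= m, m + i.+1 + 2 ^ n < size (comb n) &
    forall k, m <= k + (i.+1 + 2 ^ n) -> k <= m + (i.+1 + 2 ^ n) ->
      nth false (comb n) k = (k != m) && (m <= k + i.+1) && (k <= m + i.+1)].
Proof.
rewrite /comb /image_mem.
case/splitPr: (mem_enum 'I_n.+1 i) => r1 r2.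
rewrite map_cat flatten_cat /=; apply: block_center.
Qed.

(** * An SLP of linear size for s_n *)

(** [Some (j, true)] derives b^(j+1), one letter per rule, and [Some (j, false)] derives a^(2^j) by
    doubling. All blocks share these, so each costs five symbols in the start rule. *)
Definition comb_rule (n : nat) (A : option ('I_n.+1 * bool)) :
    seq (option ('I_n.+1 * bool) + bool) :=
  match A with
  | None =>
      let D := inl (Some (ord_max, false)) in
      flatten [seq let Y := inl (Some (i, true)) in [:: D; Y; inr false; Y; D]
              | i : 'I_n.+1]
  | Some (j, true) =>
      if val j is j'.+1 then [:: inr true; inl (Some (inord j', true))]
      else [:: inr true]
  | Some (j, false) =>
      if val j is j'.+1 then
        let D := inl (Some (inord j', false)) in [:: D; D]
      else [:: inr false]
  end.

Lemma comb_rule_acyclic (n : nat) :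
  exists2 r : option ('I_n.+1 * bool) -> nat, injective r &
    forall A B, inl B \in comb_rule A -> r A < r B.
Proof.
(* The start variable comes first, then the others by decreasing [j]; the lowest bit separates the
   two kinds. *)
exists (fun A : option ('I_n.+1 * bool) =>
    if A is Some (j, b) then (2 * (n - j) + b).+1 else 0).
  case=> [[j b]|] [[k c]|] //= [eq_r]; congr (Some (_, _)).
    apply/val_inj => /=; have := ltn_ord j; have := ltn_ord k.
    by case: b c eq_r => -[]; lia.
  by case: b c eq_r => -[] //; lia.
case=> [[[j lt_j] [|]]|] [[k c]|] //=.
- case: j lt_j => [|j] lt_j; rewrite !inE //= => /eqP[-> ->].
  by rewrite inordK; lia.
- by case: j lt_j => [|j] lt_j; rewrite !inE.
- case: j lt_j => [|j] lt_j; rewrite !inE //= orbb => /eqP[-> ->].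
  by rewrite inordK; lia.
- by case: j lt_j => [|j] lt_j; rewrite !inE.
- by move/flattenP => [_ /imageP[i _ ->]]; rewrite !inE.
Qed.

Definition comb_slp (n : nat) : slp bool := Slp None (comb_rule_acyclic n).

Lemma comb_slp_derives (n : nat) : slp_derives (comb_slp n) (comb n).
Proof.
have yield_terminal := @yield_terminal _ (comb_slp n).
have yield_var (A : slp_var (comb_slp n)) :
  dtree_yield (derivation_tree (inl A)) = slp_val A by [].
have valY j (lt_j : j < n.+1) :
    @slp_val _ (comb_slp n) (Some (inord j, true)) = nseq j.+1 true.
  elim: j lt_j => [|j IHj] lt_j; rewrite slp_valE /= inordK //=.
    by rewrite yield_terminal.
  by rewrite yield_terminal yield_var IHj ?cats0 //; lia.
have valD j (lt_j : j < n.+1) :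
    @slp_val _ (comb_slp n) (Some (inord j, false)) = nseq (2 ^ j) false.
  elim: j lt_j => [|j IHj] lt_j; rewrite slp_valE /= inordK //=.
    by rewrite yield_terminal.
  rewrite yield_var IHj ?cats0 -?nseqD ?expnS; last by lia.
  by congr nseq; lia.
rewrite /slp_derives slp_valE /= /comb /image_mem.
elim: (enum _) => //= i r IHr; rewrite IHr yield_terminal !yield_var.
have := valY _ (ltn_ord i); have := valD _ (ltnSn n).
rewrite inord_val -[inord n]/(inord (ord_max : 'I_n.+1)) inord_val => valDn ->.
by rewrite valDn /block -!catA.
Qed.

Lemma comb_slp_size (n : nat) : slp_size (comb_slp n) <= 9 * n + 11.
Proof.
rewrite /slp_size (bigD1 None) //=.
have -> : size (comb_rule (None : option ('I_n.+1 * bool))) = 5 * n.+1.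
  rewrite /= /image_mem -[in RHS](size_enum_ord n.+1).
  by elim: (enum _) => //= i r ->; lia.
(* The other rules have at most two symbols each; counting 2 for every variable, [None] included,
   gives 4n + 6. *)
have : \sum_(A : slp_var (comb_slp n) | A != None) size (comb_rule A)
    <= \sum_(A : slp_var (comb_slp n)) 2.
  rewrite big_mkcond /=; apply: leq_sum => -[[[[|j] lt_j] []]|] _ //=.
rewrite sum_nat_const card_option card_prod card_ord card_bool.
by rewrite -(leq_add2l (5 * n.+1)) => /leq_trans; apply; lia.
Qed.

(** * Summation over all blocks *)

Lemma sum_card_fibers (V I : finType) (T : eqType) (f : V -> T) (g : I -> T) :
  injective g -> \sum_i #|[pred A | f A == g i]| <= #|V|.
Proof.
move=> g_inj; under eq_bigr => i _ do rewrite -sum1_card.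
rewrite (exchange_big_dep predT) //= -sum1_card; apply: leq_sum => A _.
rewrite sum1_card; apply/card_le1_eqP => i j /eqP fi /eqP fj.
by apply: g_inj; rewrite -fi.
Qed.

(** The factor 2 arises because a variable can be counted once through its first run and once
    through its last run. *)
Lemma chomsky_comb_size (n D U : nat) (G : slp bool) :
    chomsky_nf G -> slp_derives G (comb n) ->
    (forall (A : slp_var G) l,
       l \in dtree_path_lengths (derivation_tree (inl A)) ->
       2 ^ n <= size (slp_val A) -> D <= l.-1) ->
    (forall (A : slp_var G) l,
       l \in dtree_path_lengths (derivation_tree (inl A)) ->
       size (slp_val A) <= 2 * n.+1 -> l.-1 <= U) ->
  n.+1 * D <= 2 * slp_size G + n.+1 * (U + 2).
Proof.
move=> cnf Gs D_paths U_paths.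
have inj_S : injective (fun i : 'I_n.+1 => i.+1) by move=> i j [/val_inj].
have := sum_card_fibers (fun A : slp_var G => first_run (slp_val A)) inj_S.
have := sum_card_fibers (fun A : slp_var G => first_run (rev (slp_val A))) inj_S.
have := slp_size_ge_card cnf.
suff : \sum_(i < n.+1) D <=
    \sum_(i < n.+1) (#|[pred A : slp_var G | first_run (slp_val A) == i.+1]|
      + #|[pred A : slp_var G | first_run (rev (slp_val A)) == i.+1]| + (U + 2)).
  by rewrite !big_split /= !sum_nat_const card_ord; lia.
apply: leq_sum => i _; have [m [le_m lt_m combE]] := comb_block i.
rewrite addnA; apply: card_run Gs D_paths U_paths _ le_m lt_m _ combE => //.
by have := ltn_ord i; lia.
Qed.

(** * Estimates for the logarithm and the quadratic lower bound *)

Local Open Scope ring_scope.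

Lemma log2_pow (R : realType) (n : nat) : log2 (2 ^+ n : R) = n%:R.
Proof.
have ln2_gt0 : 0 < ln (2 : R) by rewrite ln_gt0 ?ltr1n.
by rewrite /log2 lnXn // -[_ *+ n]mulr_natl mulfK ?gt_eqF.
Qed.

Lemma le_log2_nat (R : realType) (k l : nat) :
  (0 < l)%N -> (k <= l)%N -> log2 (k%:R : R) <= log2 l%:R.
Proof.
move=> l_gt0 le_kl; have ln2_gt0 : 0 < ln (2 : R) by rewrite ln_gt0 ?ltr1n.
rewrite /log2 ler_pM2r ?invr_gt0 //; case: k le_kl => [_|k le_kl].
  by rewrite ln0 // ln_ge0 // ler1n.
by rewrite ler_ln ?posrE ?ltr0n // ler_nat.
Qed.

(** This is the tangent inequality [ln (d * x) <= d * x - 1] for [d = e * ln 2], divided by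
    [ln 2]. *)
Lemma log2_linear (R : realType) (e : R) : 0 < e ->
  exists C : R, forall x : R, 0 < x -> log2 x <= e * x + C.
Proof.
move=> e_gt0; have ln2_gt0 : 0 < ln (2 : R) by rewrite ln_gt0 ?ltr1n.
pose d := e * ln 2; have d_gt0 : 0 < d by rewrite mulr_gt0.
exists (- (1 + ln d) / ln 2) => x x_gt0.
have dx_gt0 : 0 < d * x by rewrite mulr_gt0.
have : ln (1 + (d * x - 1)) <= d * x - 1 by rewrite le_ln1Dx //; lra.
rewrite addrC subrK lnM ?posrE // => le_ln.
rewrite /log2 ler_pdivrMr // mulrDl divfK ?gt_eqF //.
by rewrite mulrAC -/d; lra.
Qed.

Lemma log2_eventually_small (R : realType) (beta e c : R) :
    0 < beta -> 0 < e ->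
  exists n0 : nat, forall n : nat, (n0 <= n)%N ->
    beta * log2 (2 * n.+1)%:R + c <= e * n%:R.
Proof.
move=> beta_gt0 e_gt0.
(* With this slope the linear term becomes [e / 2 * (n + 1)], leaving [e / 2 * n] to absorb the
   constant [M]. *)
have [|C logC] := @log2_linear R (e / (4 * beta)).
  by rewrite divr_gt0 ?mulr_gt0.
pose M := e / 2 + beta * C + c; exists (Num.truncn (2 * M / e)).+1 => n le_n.
have : 2 * M / e < n%:R.
  by apply: lt_le_trans (truncnS_gt _) _; rewrite ler_nat.
rewrite ltr_pdivrMr // => lt_M.
have /logC : 0 < (2 * n.+1)%:R :> R by rewrite ltr0n.
rewrite -(ler_pM2l beta_gt0) mulrDr => le_log.
have betaE : beta * (e / (4 * beta) * (2 * n.+1)%:R) = e / 2 * (n%:R + 1).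
  by rewrite natrM -natr1; field; rewrite gt_eqF.
rewrite betaE in le_log; rewrite /M in lt_M; lra.
Qed.

(** [D] and [U] are the integer parts of [alpha * n] and [beta * log2 (2 * n.+1)]. In the constant
    3, the summand 2 comes from the integer bound and 1 from rounding [alpha * n] down. *)
Lemma path_balanced_comb_size (R : realType) (alpha beta : R) (n : nat)
    (G : slp bool) :
    0 < alpha -> 0 < beta -> path_balanced alpha beta G ->
    slp_derives G (comb n) ->
  n.+1%:R * (alpha * n%:R - (beta * log2 (2 * n.+1)%:R + 3))
    <= 2 * (slp_size G)%:R.
Proof.
move=> alpha_gt0 beta_gt0 [cnf balG] Gs.
have ge_D : alpha * n%:R < (Num.truncn (alpha * n%:R)).+1%:R by exact: truncnS_gt.
have log_ge0 : 0 <= beta * log2 (2 * n.+1)%:R.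
  by rewrite mulr_ge0 ?(ltW beta_gt0) // divr_ge0 ?ln_ge0 ?ler1n.
have /truncn_itv/andP[le_U _] := log_ge0.
have D_paths (A : slp_var G) l :
    l \in dtree_path_lengths (derivation_tree (inl A)) ->
    (2 ^ n <= size (slp_val A))%N -> (Num.truncn (alpha * n%:R) <= l.-1)%N.
  move=> lA le_N; have /andP[le_l _] := balG A l lA.
  rewrite -(ler_nat R); apply: le_trans le_l.
  have /truncn_itv/andP[le_D _] : 0 <= alpha * n%:R by rewrite mulr_ge0 // ltW.
  apply: (le_trans le_D); rewrite ler_pM2l // -log2_pow -natrX.
  by apply: le_log2_nat => //; apply: leq_trans le_N; rewrite expn_gt0.
have U_paths (A : slp_var G) l :
    l \in dtree_path_lengths (derivation_tree (inl A)) ->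
    (size (slp_val A) <= 2 * n.+1)%N ->
    (l.-1 <= Num.truncn (beta * log2 (2 * n.+1)%:R))%N.
  move=> lA le_K; have /andP[_ le_l] := balG A l lA.
  rewrite truncn_ge_nat //; apply: (le_trans le_l); rewrite ler_pM2l //.
  exact: le_log2_nat.
have le_size := chomsky_comb_size cnf Gs D_paths U_paths.
have : (n.+1 * Num.truncn (alpha * n%:R))%:R <=
    (2 * slp_size G + n.+1 * (Num.truncn (beta * log2 (2 * n.+1)%:R) + 2))%:R :> R.
  by rewrite ler_nat.
rewrite natrD !natrM natrD => {}le_size.
rewrite -natr1 in ge_D.
have : n.+1%:R * (alpha * n%:R - (beta * log2 (2 * n.+1)%:R + 3))
    <= n.+1%:R * ((Num.truncn (alpha * n%:R))%:R
                 - ((Num.truncn (beta * log2 (2 * n.+1)%:R))%:R + 2)) :> R.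
  by rewrite ler_wpM2l //; rewrite natrM in le_U *; lra.
by rewrite [leRHS]mulrBr natrM; lra.
Qed.

(* The alphabet {a, b} is bool; s 0 is a junk value of the family. *)
Theorem theorem4 (R : realType) (alpha beta : R)
    (alpha_gt0 : 0 < alpha) (le_alpha_beta : alpha <= beta) :
  exists s : nat -> seq bool,
    [/\ (exists c : R, 0 < c /\ exists n0 : nat, forall n : nat,
           (1 <= n)%N -> (n0 <= n)%N -> c * 2 ^+ n <= (size (s n))%:R),
        (exists G : nat -> slp bool,
           (forall n : nat, (1 <= n)%N -> slp_derives (G n) (s n)) /\
           exists c : R, 0 < c /\ exists n0 : nat, forall n : nat,
             (1 <= n)%N -> (n0 <= n)%N -> (slp_size (G n))%:R <= c * n%:R) &
        (exists c : R, 0 < c /\ exists n0 : nat, forall n : nat,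
           (1 <= n)%N -> (n0 <= n)%N ->
           forall H : slp bool,
             path_balanced alpha beta H -> slp_derives H (s n) ->
             c * n%:R ^+ 2 <= (slp_size H)%:R)].
Proof.
have beta_gt0 : 0 < beta by exact: lt_le_trans le_alpha_beta.
exists comb; split.
- exists 1; split=> //; exists 0%N => n _ _.
  rewrite mul1r -natrX ler_nat.
  by have [m [_ lt_m _]] := comb_block (ord0 : 'I_n.+1); lia.
- exists comb_slp; split=> [n _|]; first exact: comb_slp_derives.
  (* 20 = 9 + 11, as [n] is at least 1. *)
  exists 20; split=> //; exists 0%N => n n_gt0 _.
  by rewrite -natrM ler_nat; have := comb_slp_size n; lia.
(* From [n0] on, the logarithmic loss eats at most half of [alpha * n]. *)
have [|n0 logn] := @log2_eventually_small R beta (alpha / 2) 3 beta_gt0.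
  by rewrite divr_gt0.
(* One half is lost to the logarithm, the other to the double counting of variables. *)
exists (alpha / 4); split; first by rewrite divr_gt0.
exists n0 => n _ /logn le_log H balH Hs.
have := path_balanced_comb_size alpha_gt0 beta_gt0 balH Hs.
have : n%:R * (alpha / 2 * n%:R) <=
    n.+1%:R * (alpha * n%:R - (beta * log2 (2 * n.+1)%:R + 3)) :> R.
  apply: ler_pM => //; first by rewrite mulr_ge0 ?divr_ge0 // ltW.
    by rewrite ler_nat.
  lra.
by rewrite expr2; lra.
Qed.
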